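(* There exist a dynamical system $(X,f)$ and three points $x_1,x_2,x_3\in X$ such that $x_3\in J_\alpha(x_1)$ and $x_3\in J_\alpha(x_2)$ for some ordinal $\alpha$ with $\alpha=\min\{\beta\mid x_3\in J_\beta(x_1)\}=\min\{\beta\mid x_3\in J_\beta(x_2)\}$, and $\Omega(x_1,x_3)\neq\Omega(x_2,x_3)$.
   Context: A dynamical system $(X,f)$ is a metric space $(X,d)$ with a continuous map $f:X\to X$. Write $x\,\mathcal{N}\,y$ if for every $\varepsilon>0$ there are $z\in B_\varepsilon(x)$ and an integer $k\ge1$ with $f^k(z)\in B_\varepsilon(y)$. The prolongational sets are defined by $J_1(x)=\{y\in X\mid x\,\mathcal{N}\,y\}$ and, for ordinals $\alpha>1$, $J_\alpha(x)=\bigcap_{\varepsilon>0}\overline{\bigcup_{n=1}^\infty\bigcup_{1\le\beta<\alpha}(J_\beta)^n(B_\varepsilon(x))}$, where $J_\beta(B)=\bigcup_{b\in B}J_\beta(b)$, $(J_\beta)^1=J_\beta$, $(J_\beta)^n=J_\beta((J_\beta)^{n-1})$. For $\varepsilon>0$, an $\varepsilon$-chain from $x$ to $y$ is a finite indexed sequence $C:x_0,\dots,x_m$ in $X$ with $m\ge1$, $x_0=x$, $x_m=y$, $d(f(x_i),x_{i+1})<\varepsilon$ for $0\le i<m$; its support is $\widehat C=\{x_0,\dots,x_m\}$. It is acyclic if $x_1,\dots,x_{m-1}$ are pairwise distinct and none equals $x_0$ or $x_m$ ($x_0=x_m$ is allowed). An acyclic chain $S_n$ induces on $\widehat{S_n}$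 the relation $\le_n$: $u\le_n v$ iff $u=x_i,v=x_j$ for some $i\le j$ (a linear order on $\widehat{S_n}\setminus\{x,y\}$). A complete sequence of order-compatible nested chains from $x$ to $y$ is a sequence $\{S_n\}$ where $S_n$ is an acyclic $\varepsilon_n$-chain from $x$ to $y$ for some positive reals $\varepsilon_n$ converging monotonically to $0$, $\widehat{S_n}\subseteq\widehat{S_{n+1}}$, and $u\le_n v$ implies $u\le_{n+1}v$ for $u,v\in\widehat{S_n}$. With $S=\bigcup_n\widehat{S_n}$, the limit order on $S\setminus\{x,y\}$ is: $u\le_\infty v$ iff $u\le_n v$ for every $n$ with $u,v\in\widehat{S_n}$. The emergent order spectrum $\Omega(x,y)=\Omega_f(x,y)$ is the set of all order-types of $(S\setminus\{x,y\},\le_\infty)$ arising from complete sequences of order-compatible nested chains from $x$ to $y$ (empty if there are none). *)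

(* Defs.v *)
From HB Require Import structures.
From mathcomp Require Import all_boot all_order all_algebra.
From mathcomp Require Import all_classical all_reals all_analysis.

Set Implicit Arguments.
Unset Strict Implicit.
Unset Printing Implicit Defensive.

Import Order.TTheory GRing.Theory Num.Theory.
Import numFieldNormedType.Exports.

Local Open Scope classical_set_scope.
Local Open Scope ring_scope.

(* [Ord_sup I a] denotes the least ordinal strictly above all the [a i].
   Different trees may denote the same ordinal: equality of ordinals is
   [Ord_le] in both directions, not Leibniz equality of trees. *)
Inductive Ord : Type := Ord_sup (I : Type) of I -> Ord.

Fixpoint Ord_le (a b : Ord) {struct a} : Prop :=
  let: Ord_sup T f := a in
  forall i, (fix lt_sup (b : Ord) : Prop :=
    let: Ord_sup K g := b in exists k, Ord_le (f i) (g k)) b.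

Definition Ord_lt (a b : Ord) : Prop :=
  let: Ord_sup K g := b in exists k, Ord_le a (g k).

Definition Ord0 : Ord := @Ord_sup void (fun v => match v with end).
Definition Ord1 : Ord := @Ord_sup unit (fun=> Ord0).

Lemma Ord_leE I (f : I -> Ord) b :
  Ord_le (Ord_sup f) b <-> forall i, Ord_lt (f i) b.
Proof. by case: b. Qed.

Lemma Ord_le_refl a : Ord_le a a.
Proof. by elim: a => I f IH /= i; exists i. Qed.

Lemma Ord_le_trans a b c : Ord_le a b -> Ord_le b c -> Ord_le a c.
Proof.
elim: a b c => I f IH [K g] [L h] ab bc i.
by have [k fg] := ab i; have [l gh] := bc k; exists l; exact: IH fg gh.
Qed.

Lemma Ord_le_lt_trans a b c : Ord_le a b -> Ord_lt b c -> Ord_lt a c.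
Proof. by case: c => K g ab [k bg]; exists k; exact: Ord_le_trans bg. Qed.

Lemma Ord_lt_le_trans a b c : Ord_lt a b -> Ord_le b c -> Ord_lt a c.
Proof.
case: b => K g [k ag] /Ord_leE bc; exact: Ord_le_lt_trans ag (bc k).
Qed.

Lemma Ord_lt_wf : well_founded Ord_lt.
Proof.
suff H a : forall b, Ord_le b a -> Acc Ord_lt b.
  by move=> a; exact: H (Ord_le_refl a).
elim: a => K g IH b ba; constructor => c cb.
by have [k ck] := Ord_lt_le_trans cb ba; exact: IH ck.
Qed.

Lemma Ord_lt_irr a : ~ Ord_lt a a.
Proof.
by elim/(well_founded_ind Ord_lt_wf): a => a IH aa; exact: (IH _ aa aa).
Qed.

Lemma Ord_le_total a b : Ord_le a b \/ Ord_lt b a.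
Proof.
elim: a b => I f IH b.
have [?|/Ord_leE/existsNP[i nfb]] := pselect (Ord_le (Ord_sup f) b); first by left.
right; exists i; case: b nfb => K g nfb; apply/Ord_leE => k.
by have [fg|] := IH i (g k); first by case: nfb; exists k.
Qed.

Lemma Ord1_leE a : Ord_le Ord1 a <-> exists b, Ord_lt b a.
Proof.
rewrite /Ord1 Ord_leE; split => [/(_ tt) ?|[b ba] i]; first by exists Ord0.
by apply: Ord_le_lt_trans ba; apply/Ord_leE; case.
Qed.

(* [a] is the minimum of [A], up to equality of ordinals. *)
Definition Ord_is_min (A : set Ord) (a : Ord) : Prop :=
  A a /\ forall b, A b -> Ord_le a b.

Section Prolongation.
Context {R : realType} {X : metricType R} (f : X -> X).

Definition prolong (x y : X) : Prop :=
  forall e : R, 0 < e -> exists z (k : nat),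
    [/\ ball x e z, (1 <= k)%N & ball y e (iter k f z)].

Definition set_image (g : X -> set X) (B : set X) : set X :=
  \bigcup_(b in B) g b.

(* Only the ordinals [a] with [Ord_le Ord1 a] are meaningful; the value at
   the ordinal 0 is junk. *)
Definition J : Ord -> X -> set X :=
  Fix Ord_lt_wf (fun=> X -> set X) (fun a Jlt x =>
    if `[< Ord_le a Ord1 >] then [set y | prolong x y] else
    \bigcap_(e in [set e : R | 0 < e])
      closure (\bigcup_(n in [set n : nat | (1 <= n)%N])
        \bigcup_(b in [set b : {b | Ord_lt b a} | Ord_le Ord1 (sval b)])
          iter n (set_image (Jlt (sval b) (svalP b))) (ball x e))).

Lemma J_def a x : J a x =
  if `[< Ord_le a Ord1 >] then [set y | prolong x y] else
  \bigcap_(e in [set e : R | 0 < e])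
    closure (\bigcup_(n in [set n : nat | (1 <= n)%N])
      \bigcup_(b in [set b | Ord_le Ord1 b /\ Ord_lt b a])
        iter n (set_image (J b)) (ball x e)).
Proof.
rewrite /J Fix_eq.
  case: ifP => // _; apply: eq_bigcapr => e _; congr closure.
  apply: eq_bigcupr => n _; apply/seteqP; split => z.
    by case=> -[b ba] /= b1 H; exists b.
  by case=> b [b1 ba] H; exists (exist _ b ba).
move=> b g h gh; apply/funext => y.
case: ifP => // _; apply: eq_bigcapr => e _; congr closure.
apply: eq_bigcupr => n _; apply: eq_bigcupr => c _.
by rewrite gh.
Qed.

Lemma J_1 x : J Ord1 x = [set y | prolong x y].
Proof. by rewrite J_def asboolT//; exact: Ord_le_refl. Qed.

Lemma J_gt1 a x : Ord_lt Ord1 a -> J a x =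
  \bigcap_(e in [set e : R | 0 < e])
    closure (\bigcup_(n in [set n : nat | (1 <= n)%N])
      \bigcup_(b in [set b | Ord_le Ord1 b /\ Ord_lt b a])
        iter n (set_image (J b)) (ball x e)).
Proof.
move=> a1; rewrite J_def asboolF// => le1.
exact: Ord_lt_irr (Ord_lt_le_trans a1 le1).
Qed.

End Prolongation.

(* An order type is an isomorphism class of ordered sets. Such classes are
   plain predicates because [set ordered_set] would be a universe
   inconsistency. *)
Record ordered_set := OrderedSet {
  os_carrier : Type;
  os_le : os_carrier -> os_carrier -> Prop }.

Definition order_isomorphic (A B : ordered_set) : Prop :=
  exists phi : os_carrier A -> os_carrier B,
    bijective phi /\ forall u v, os_le u v <-> os_le (phi u) (phi v).

Definition order_type (A : ordered_set) : ordered_set -> Prop :=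
  fun B => order_isomorphic A B.

Section EmergentOrder.
Context {R : realType} {X : metricType R} (f : X -> X).

(* The chain x_0, ..., x_m is the sequence [x :: p], where x_0 = [x] and
   [p] = x_1, ..., x_m. *)
Definition is_chain (e : R) (x y : X) (p : seq X) : Prop :=
  [/\ (1 <= size p)%N, path (fun u v => mdist (f u) v < e) x p
    & last x p = y].

Definition chain_supp (x : X) (p : seq X) : set X := [set` x :: p].

(* [behead (belast x p)] = x_1, ..., x_{m-1} *)
Definition acyclic_chain (x : X) (p : seq X) : Prop :=
  let inner := behead (belast x p) in
  [/\ uniq inner, x \notin inner & last x p \notin inner].

Definition chain_le (x : X) (p : seq X) (u v : X) : Prop :=
  exists i j : nat, [/\ (i <= j <= size p)%N,
    u = nth x (x :: p) i & v = nth x (x :: p) j].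

Definition complete_nested_chains (x y : X) (S : nat -> seq X) : Prop :=
  exists eps : nat -> R,
  [/\ forall n, 0 < eps n,
      (forall n, eps n.+1 <= eps n) /\ eps n @[n --> \oo] --> (0 : R),
      forall n, is_chain (eps n) x y (S n) /\ acyclic_chain x (S n),
      forall n, chain_supp x (S n) `<=` chain_supp x (S n.+1)
    & forall n u v, chain_supp x (S n) u -> chain_supp x (S n) v ->
        chain_le x (S n) u v -> chain_le x (S n.+1) u v].

Definition limit_le (x : X) (S : nat -> seq X) (u v : X) : Prop :=
  forall n, chain_supp x (S n) u -> chain_supp x (S n) v ->
    chain_le x (S n) u v.

Definition limit_order (x y : X) (S : nat -> seq X) : ordered_set :=
  @OrderedSet
    (set_type ((\bigcup_n chain_supp x (S n)) `\` [set x; y]))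
    (fun u v => limit_le x S (val u) (val v)).

Definition Omega (x y : X) : (ordered_set -> Prop) -> Prop :=
  fun t => exists2 S, complete_nested_chains x y S
                    & t = order_type (limit_order x y S).

End EmergentOrder.

(* Main.v *)
Require Import Defs.
From HB Require Import structures.
From mathcomp Require Import all_boot all_order all_algebra.
From mathcomp Require Import all_classical all_reals all_analysis.

(** The empty order type belongs to [Omega f x y] exactly when [f x = y], since
    the only acyclic chains without intermediate points are [x, y]. For the
    translation [x |-> x + 1] of the real line, both [1] and [0] reach [2] by
    iteration, so [2] lies in [J_1] of both, but [1] does so in one step and
    [0] does not. *)

Set Implicit Arguments.
Unset Strict Implicit.
Unset Printing Implicit Defensive.

Import Order.TTheory GRing.Theory Num.Theory.
Import numFieldNormedType.Exports.

Local Open Scope classical_set_scope.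
Local Open Scope ring_scope.

Section OneStep.
Context {R : realType} {X : metricType R} (f : X -> X).

Lemma prolong_iter (x : X) (k : nat) : (1 <= k)%N -> prolong f x (iter k f x).
Proof. by move=> k1 e e0; exists x, k; split=> //; exact: ballxx. Qed.

(** Only the membership at [Ord1] needs an argument, since every competing ordinal is at least
    [Ord1] by the first conjunct. *)
Lemma J_iter_min (x : X) (k : nat) : (1 <= k)%N ->
  Ord_is_min [set b | Ord_le Ord1 b /\ J f b x (iter k f x)] Ord1.
Proof.
move=> k1; split=> [|b []//]; split; first exact: Ord_le_refl.
by rewrite J_1; exact: prolong_iter.
Qed.

(** The only jump has error zero, so the same chain serves every positive tolerance; [harmonic] is
    one sequence decreasing to 0. *)
Lemma one_step_complete_nested_chains (x : X) :
  complete_nested_chains f x (f x) (fun=> [:: f x]).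
Proof.
exists (@harmonic R); split=> //.
- by move=> n; exact: harmonic_gt0.
- split; last exact: cvg_harmonic.
  by move=> n; rewrite /harmonic/= lef_pV2 ?posrE ?ltr0n// ler_nat.
- by move=> n; split=> //; split=> //=; rewrite mdistxx harmonic_gt0.
- by move=> n; exact: subset_refl.
Qed.

Lemma one_step_limit_order_empty (x : X) :
  os_carrier (limit_order x (f x) (fun=> [:: f x])) -> False.
Proof.
case=> u /set_mem[[n _]]; rewrite /chain_supp/= !inE => ux; apply.
by case/orP: ux => /eqP ->; [left|right].
Qed.

Lemma acyclic_chain_no_inner e (x y : X) (p : seq X) :
  is_chain f e x y p -> acyclic_chain x p ->
  chain_supp x p `<=` [set x; y] -> p = [:: y].
Proof.
(* If [p] has at least two entries, its first entry [a] is an inner point, so by acyclicity it is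
   neither endpoint. *)
case: p => [[//]|a [|b q]] [_ _ <-//] [_ xi yi] /(_ a).
case; first by rewrite /chain_supp/= !inE eqxx orbT.
- by move=> ax; move: xi; rewrite ax /= inE eqxx.
- by move=> /= ay; move: yi; rewrite /= -ay inE eqxx.
Qed.

(** Without intermediate points every chain is the single jump from [x] to [y], which bounds
    [mdist (f x) y] by tolerances tending to 0. *)
Lemma limit_order_empty_step (x y : X) (S : nat -> seq X) :
  complete_nested_chains f x y S ->
  (os_carrier (limit_order x y S) -> False) -> f x = y.
Proof.
move=> [eps [eps0 [_ eps_cvg] ch _ _]] emp.
have SE n : S n = [:: y].
  have [chn acn] := ch n; apply: acyclic_chain_no_inner chn acn _ => u un.
  apply: contrapT => nu; apply: emp.
  by exists u; apply/mem_set; split=> //; exists n.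
have le_eps n : mdist (f x) y <= eps n.
  by have [[_ + _] _] := ch n; rewrite SE /= andbT => /ltW.
have : mdist (f x) y <= 0.
  by rewrite -(cvg_lim (@Rhausdorff R) eps_cvg); apply: limr_ge;
    [apply/cvg_ex; exists 0 | near=> n].
move=> d0; apply: mdist_positivity; apply/eqP.
by rewrite eq_le d0 mdist_ge0.
Unshelve. all: by end_near.
Qed.

Lemma Omega_one_step_neq (x1 x2 : X) :
  f x2 <> f x1 -> Omega f x1 (f x1) <> Omega f x2 (f x1).
Proof.
move=> ne OE; apply: ne.
have : Omega f x1 (f x1)
    (order_type (limit_order x1 (f x1) (fun=> [:: f x1]))).
  by exists (fun=> [:: f x1]) => //; exact: one_step_complete_nested_chains.
(* An equality of order types, evaluated at the empty order [A], yields an isomorphism onto [A]; its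
   map [phi] would send [u] into an empty carrier. *)
rewrite OE => -[S chS tE]; apply: (limit_order_empty_step chS) => u.
set A := limit_order x1 _ _ in tE *.
have AA : order_type A A by exists idfun; split=> //; exact: inv_bij.
move: AA; rewrite tE => -[phi _].
exact: (@one_step_limit_order_empty x1 (phi u)).
Qed.

End OneStep.

Theorem theorem6p4 (R : realType) :
  exists (X : metricType R) (f : X -> X) (x1 x2 x3 : X),
    [/\ continuous f,
        uniq [:: x1; x2; x3],
        exists a : Ord,
          [/\ J f a x1 x3,
              J f a x2 x3,
              Ord_is_min [set b | Ord_le Ord1 b /\ J f b x1 x3] a
            & Ord_is_min [set b | Ord_le Ord1 b /\ J f b x2 x3] a]
      & Omega f x1 x3 <> Omega f x2 x3].
Proof.
pose f (x : R^o) : R^o := x + 1.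
exists R^o, f, 1, 0, (f 1); split.
- by move=> x; apply: cvgD; [exact: cvg_id|exact: cvg_cst].
- rewrite /f /= !inE !negb_or oner_eq0 /= andbT; apply/andP; split.
    by rewrite -subr_eq0 opprD addrA subrr add0r oppr_eq0 oner_eq0.
  by rewrite eq_sym -[1 + 1]/(2%:R : R) pnatr_eq0.
(* The point [f 1] is one iterate away from 1 and two from 0; [J Ord1] does not see this
   difference. *)
- have m1 := @J_iter_min R R^o f 1 1 isT.
  have m0 := @J_iter_min R R^o f 0 2 isT.
  have f01 : iter 2 f 0 = f 1 by rewrite /= /f add0r.
  rewrite f01 in m0.
  by exists Ord1; split=> //; [case: m1 => -[] | case: m0 => -[]].
- apply: Omega_one_step_neq; rewrite /f => /addIr/eqP.
  by rewrite eq_sym oner_eq0.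
Qed.
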